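(* Let $E$ and $F$ be $n\times n$ complex matrices with Drazin inverses $E^D,F^D$, put $E^{\pi}=I-EE^D$, $F^{\pi}=I-FF^D$, let $s=i(E)$ and $t=i(F)$ be the indices of $E$ and $F$, and let $M=\begin{pmatrix}E&I\\ F&0\end{pmatrix}$. If $EF^2=0$ and $EFE=0$, then $$M^D=\begin{pmatrix}\Gamma&\Delta\\ \Lambda&\Xi\end{pmatrix},$$ where $$\begin{aligned} \Gamma={}&E^D+(E^D)^3F-F^DE^DF-(F^D)^2E^2E^DF-FF^DE^D+F^DEE^{\pi}+(F^D)^2EF\\ &-FF^D(E^D)^3F+(F^D)^3E^3E^{\pi}F+\sum_{i=1}^{t}F^{i}F^{\pi}E^{2i+1}+\sum_{i=1}^{[s/2]}(F^D)^{i+1}E^{2i+1}E^{\pi}\\ &+\sum_{i=1}^{t}F^{i}F^{\pi}E^{2i}E^DF+\sum_{i=1}^{[s/2]-1}(F^D)^{i+3}E^{2i+3}E^{\pi}F, \end{aligned}$$ $$\begin{aligned} \Delta={}&(E^D)^2+(E^D)^4F-F^D(E^D)^2F-(F^D)^2EE^DF-FF^D(E^D)^2+F^DE^{\pi}\\ &-FF^D(E^D)^4F+(F^D)^3E^2E^{\pi}F+\sum_{i=1}^{t}F^iF^{\pi}E^{2i+1}E^D+\sum_{i=1}^{[s/2]+1}(F^D)^{i+1}E^{2i}E^{\pi}\\ &+\sum_{i=1}^{t}F^iF^{\pi}E^{2i-1}E^DF+\sum_{i=1}^{[s/2]}(F^D)^{i+3}E^{2i+2}E^{\pi}F, \end{aligned}$$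 $$\begin{aligned} \Lambda={}&FF^{\pi}(E^D)^2+FF^DE^{\pi}+FF^{\pi}(E^D)^4F+(F^D)^2E^2E^{\pi}F-FF^D(E^D)^2F-F^DEE^DF\\ &+\sum_{i=1}^{t-1}F^{i+1}F^{\pi}(E^D)^{2i+2}+\sum_{i=1}^{[s/2]+1}(F^D)^iE^{2i}E^{\pi}+\sum_{i=1}^{t-1}F^{i+1}F^{\pi}(E^D)^{2i+4}F\\ &+\sum_{i=1}^{[s/2]}(F^D)^{i+2}E^{2i+2}E^{\pi}F, \end{aligned}$$ $$\begin{aligned} \Xi={}&-FF^D(E^D)^3F-F^DE^DF+FF^{\pi}(E^D)^3-FF^DE^D+FF^{\pi}(E^D)^5F-(F^D)^2E^2E^DF+(F^D)^2EF\\ &+\sum_{i=1}^{t-1}F^{i+1}F^{\pi}(E^D)^{2i+3}+\sum_{i=1}^{[s/2]+1}(F^D)^iE^{2i-1}E^{\pi}+\sum_{i=1}^{t-1}F^{i+1}F^{\pi}(E^D)^{2i+5}F\\ &+\sum_{i=1}^{[s/2]}(F^D)^{i+2}E^{2i+1}E^{\pi}F. \end{aligned}$$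
   Context: A square complex matrix $A$ has a unique Drazin inverse $A^D$: the matrix $B$ with $AB=BA$, $B=BAB$ and $A^k=A^{k+1}B$ for some integer $k\ge 0$. The smallest such $k$ is the index $i(A)$ of $A$. $I$ is the $n\times n$ identity matrix, $[x]$ denotes the integer part of $x$, and a sum whose upper limit is smaller than its lower limit is $0$.
   Formalization: In the four sums over i=1..t in Γ and Δ, the powers of E after F^iF^π (E^{2i+1}, E^{2i} in Γ; E^{2i+1}, E^{2i-1} in Δ) are replaced by (E^D)^{2i+1}, (E^D)^{2i+2}; (E^D)^{2i+1}, (E^D)^{2i+3}. As printed it fails for E=diag(2,0), F=e_21. *)

(* Defs.v *)
From mathcomp Require Import all_boot all_algebra.
From mathcomp Require Import boolp.

Set Implicit Arguments.
Unset Strict Implicit.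
Unset Printing Implicit Defensive.

Import GRing.Theory.
Local Open Scope ring_scope.

(* In the upper blocks of the Drazin inverse of [E, I; F, 0], the summands
   F^i F^pi (E^D)^(2i+1), F^i F^pi (E^D)^(2i+2) E^D F (upper left) and
   F^i F^pi (E^D)^(2i+1) E^D, F^i F^pi (E^D)^(2i+3) E^D F (upper right)
   correct the misprinted source formulas, which have respectively
   F^i F^pi E^(2i+1), F^i F^pi E^(2i) E^D F and
   F^i F^pi E^(2i+1) E^D, F^i F^pi E^(2i-1) E^D F.
   With the latter each upper block is wrong for E = 2 e_11 and
   F = e_21 + e_13 (3 x 3 matrix units). *)

Definition is_drazin (K : fieldType) (n : nat) (A B : 'M[K]_n) : Prop :=
  [/\ A * B = B * A, B = B * A * B & exists k, A ^+ k = A ^+ k.+1 * B].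

Section Drazin.
Variables (K : fieldType) (n : nat).
Implicit Types A B C D : 'M[K]_n.

Lemma is_drazin_of_comm A C k :
  GRing.comm A C -> A ^+ k = A ^+ k.+1 * C -> is_drazin A (A ^+ k * C ^+ k.+1).
Proof.
move=> cAC Ak.
have AkD j : A ^+ k * (A * C) ^+ j = A ^+ k.
  elim: j => [|j IHj]; first by rewrite mulr1.
  by rewrite exprS mulrA [A ^+ k * _]mulrA -exprSr -Ak.
have cAkC : GRing.comm (A ^+ k) (C ^+ k.+1).
  exact/commrX/commr_sym/commrX/commr_sym.
have cACk : GRing.comm A (C ^+ k.+1) by exact: commrX.
split.
- exact: (commrM (commrX k (commr_refl A)) cACk).
- have BE : A ^+ k * (A ^+ k.+1 * C ^+ k.+1) = A ^+ k.
    by rewrite -exprMn_comm // AkD.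
  rewrite -[RHS]mulrA [A * (_ * _)]mulrA -exprS [in RHS]cAkC -[RHS]mulrA BE.
  exact: cAkC.
- exists k; rewrite mulrA -exprD addnC exprD -mulrA -exprMn_comm //.
Qed.

Lemma is_drazin_uniq A B B' : is_drazin A B -> is_drazin A B' -> B = B'.
Proof.
have idem D k : is_drazin A D -> A * D = A ^+ k.+1 * D ^+ k.+1.
  case=> cAD DAD _; rewrite -exprMn_comm //.
  elim: k => [|k IHk] //; rewrite exprS -IHk -mulrA [D * _]mulrA -DAD //.
suff half C D : is_drazin A C -> is_drazin A D ->
    A * C * (A * D) = A * D /\ A * D * (A * C) = A * D.
  move=> dB dB'; have [cAB BAB _] := dB; have [_ BAB' _] := dB'.
  have [e1 _] := half _ _ dB dB'; have [_ e2] := half _ _ dB' dB.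
  have ee : A * B = A * B' by rewrite -e1 e2.
  by rewrite BAB -mulrA ee mulrA -cAB ee [RHS]BAB'; case: dB' => ->.
move=> dC dD; have [cAC _ [k Ak]] := dC; have [cAD _ _] := dD.
have AkC : A ^+ k.+1 * (A * C) = A ^+ k.+1.
  by rewrite mulrA -exprSr exprS -mulrA -Ak -exprS.
have cA : GRing.comm (A ^+ k.+1) (A * C).
  by apply/commr_sym/commrX/commr_sym/commrM.
have cD : GRing.comm (A ^+ k.+1) (D ^+ k.+1).
  by apply/commrX/commr_sym/commrX/commr_sym.
rewrite (idem D k dD); split; first by rewrite mulrA -cA AkC.
by rewrite cD -mulrA AkC.
Qed.

End Drazin.

Lemma is_drazin_exists (K : fieldType) (n : nat) (A : 'M[K]_n) :
  exists B, is_drazin A B.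
Proof.
case: n A => [|n] A.
  by exists 0; split; [| |exists 0%N]; apply/matrixP => -[].
have pA0 : char_poly A != 0 by rewrite monic_neq0 ?char_poly_monic.
have [m [q q0 pE]] := multiplicity_XsubC (char_poly A) 0.
rewrite pA0 /= subr0 in q0 pE.
have Aq : A ^+ m * horner_mx A q = 0.
  by rewrite -(Cayley_Hamilton A) pE mulrC rmorphM rmorphXn /= horner_mx_X.
have [r rE] : exists r, q - q.[0]%:P = r * 'X.
  have /factor_theorem[r] : root (q - q.[0]%:P) 0.
    by rewrite rootE !hornerE subrr.
  by rewrite subr0 => ->; exists r.
pose C := horner_mx A (- (q.[0])^-1 *: r).
have cAC : GRing.comm A C by apply: comm_mx_horner.
eexists; apply: (@is_drazin_of_comm _ _ _ C m) => //.
have -> : A ^+ m = A ^+ m * horner_mx A (1 - (q.[0])^-1 *: q).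
  by rewrite raddfB /= linearZ /= mulrBr -scalerAr Aq scaler0 subr0 rmorph1 mulr1.
rewrite exprSr -!mulrA; congr (_ * _).
rewrite -{2}(horner_mx_X A) -rmorphM -/C; congr horner_mx.
rewrite -scalerAr mulrC -rE scaleNr scalerBr opprB; congr (_ - _).
by rewrite -mul_polyC -polyCM mulVf.
Qed.

Definition drazin (K : fieldType) (n : nat) (A : 'M[K]_n) : 'M[K]_n :=
  sval (cid (is_drazin_exists A)).

Lemma drazinP (K : fieldType) (n : nat) (A : 'M[K]_n) : is_drazin A (drazin A).
Proof. exact: svalP (cid (is_drazin_exists A)). Qed.

Lemma drazin_index_exists (K : fieldType) (n : nat) (A : 'M[K]_n) :
  exists k, A ^+ k == A ^+ k.+1 * drazin A.
Proof. by have [_ _ [k /eqP ?]] := drazinP A; exists k. Qed.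

Definition drazin_index (K : fieldType) (n : nat) (A : 'M[K]_n) : nat :=
  ex_minn (drazin_index_exists A).

(* Main.v *)
Require Import Defs.
From mathcomp Require Import all_boot all_algebra reals complex.
From mathcomp Require Import zify ring.

Set Implicit Arguments.
Unset Strict Implicit.
Unset Printing Implicit Defensive.

Import GRing.Theory.
Local Open Scope ring_scope.

(* Write e = E^D, f = F^D, G = E^2, g = e^2, M = [E, I; F, 0].  The triangular
   matrix T = [F, I; 0, G] has Drazin inverse [f, X; 0, g] with X given by the
   Meyer-Rose formula.  The matrix
     R = [(F+G)E + EF, F+G; G(GE+EF), G(G+F)]
   satisfies T R = R M^2, and intertwining passes to Drazin inverses, so
   T^D R = R (M^D)^2.  The first block row of R is that of M^3, hence the first
   block row of M^D is that of (T^D)^2 R, i.e. FXE + e + XEF and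
   FX + g + XF - f; the second block row follows from M M^D = M^D M. *)

(** * Powers, idempotents and intertwining for Drazin inverses *)

Section DrazinTheory.
Variables (K : fieldType) (n : nat).
Implicit Types A B C S T : 'M[K]_n.

Lemma drazin_eq A B : is_drazin A B -> drazin A = B.
Proof. exact/is_drazin_uniq/drazinP. Qed.

Lemma drazinC A : A * drazin A = drazin A * A.
Proof. by have [] := drazinP A. Qed.

Lemma drazinK A : drazin A * A * drazin A = drazin A.
Proof. by have [_ <- _] := drazinP A. Qed.

Lemma mul_drazinX A k : A * drazin A ^+ k.+2 = drazin A ^+ k.+1.
Proof. by rewrite !exprS !mulrA drazinC drazinK. Qed.

Lemma drazinX_mul A k : drazin A ^+ k.+2 * A = drazin A ^+ k.+1.
Proof. by rewrite !exprSr -!mulrA -drazinC [drazin A * _]mulrA drazinK. Qed.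

Lemma mulX_drazinX A k j : A ^+ k * drazin A ^+ (k + j).+1 = drazin A ^+ j.+1.
Proof.
elim: k => [|k IHk]; first by rewrite mul1r.
by rewrite exprSr -mulrA addSn mul_drazinX.
Qed.

Lemma mulX_drazin_idem A i :
  (drazin_index A <= i)%N -> A ^+ i * (1 - A * drazin A) = 0.
Proof.
rewrite /drazin_index; case: ex_minnP => k /eqP Ak _ /subnK <-.
by rewrite exprD -mulrA mulrBr mulr1 mulrA -exprSr -Ak subrr mulr0.
Qed.

Lemma drazin_commX A k j : A ^+ k * drazin A ^+ j = drazin A ^+ j * A ^+ k.
Proof. exact/commrX/commr_sym/commrX/commr_sym/drazinC. Qed.

Lemma mulX_drazin_ge A i j :
  (drazin_index A <= i)%N -> A ^+ (i + j) * drazin A ^+ j = A ^+ i.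
Proof.
move=> si; rewrite exprD -mulrA -exprMn_comm; last exact: drazinC.
have Ai : A ^+ i * (A * drazin A) = A ^+ i.
  by apply/esym/eqP; rewrite -subr_eq0 -[X in X - _]mulr1 -mulrBr mulX_drazin_idem.
by elim: j => [|j IHj]; rewrite ?mulr1 // exprS mulrA Ai.
Qed.

Lemma mul_drazin_idem0 A : drazin A * (1 - A * drazin A) = 0.
Proof. by rewrite mulrBr mulr1 mulrA drazinK subrr. Qed.

Lemma drazin_idem_mul0 A : (1 - A * drazin A) * drazin A = 0.
Proof. by rewrite mulrBl mul1r drazinC drazinK subrr. Qed.

Lemma drazin_idem_comm A : (1 - A * drazin A) * A = A * (1 - A * drazin A).
Proof. by rewrite mulrBl mulrBr mul1r mulr1 -mulrA -drazinC. Qed.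

(** The hypothesis passes to powers: A^k S = S T^k. For [N] at least both indices, A^D = (A^D)^(N+1)
    A^N and T^N = T^(2N+1) (T^D)^(N+1), so A^D S becomes S T^D by moving only powers of [A] and [T]
    across [S]. *)
Lemma drazin_intertwine A S T :
  A * S = S * T -> drazin A * S = S * drazin T.
Proof.
move=> AST; have ASTX k : A ^+ k * S = S * T ^+ k.
  elim: k => [|k IHk]; first by rewrite mul1r mulr1.
  by rewrite exprSr -mulrA AST mulrA IHk -mulrA -exprSr.
pose N := (drazin_index A + drazin_index T)%N.
have DE B : B ^+ N * drazin B ^+ N.+1 = drazin B.
  by rewrite -[N in N.+1]addn0 mulX_drazinX.
rewrite -[in LHS]DE drazin_commX -mulrA ASTX.
rewrite -(@mulX_drazin_ge T N N.+1) ?leq_addl //.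
rewrite [S * _]mulrA -ASTX -[_ * S * _]mulrA [LHS]mulrA -drazin_commX.
by rewrite mulX_drazin_ge ?leq_addr // mulrA ASTX -mulrA DE.
Qed.

Lemma drazin_sqr A : drazin (A ^+ 2) = drazin A ^+ 2.
Proof.
apply: drazin_eq; split.
- exact: drazin_commX.
- by rewrite -drazin_commX -mulrA -exprD (mulX_drazinX A 2 1).
- exists (drazin_index A).
  rewrite -!exprM mulnSr mulX_drazin_ge //.
  by rewrite leq_pmull.
Qed.

End DrazinTheory.

(** The sums of the theorem start at 1, with various lengths and offsets. Since [v] vanishes from
    [L] on, each equals the sum up to one common [N] minus the [d] initial terms that it skips. *)
Lemma sum_from1 (V : zmodType) (u v : nat -> V) (d k N L : nat) :
    (forall i, u i.+1 = v (i + d)%N) -> (forall i, (L <= i)%N -> v i = 0) ->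
    (L <= k.-1 + d)%N -> (L <= N)%N ->
  \sum_(1 <= i < k) u i = \sum_(0 <= i < N) v i - \sum_(0 <= i < d) v i.
Proof.
move=> uv v0 Lk LN.
have stable M : (L <= M)%N -> \sum_(0 <= i < M) v i = \sum_(0 <= i < L) v i.
  move=> LM; rewrite (big_cat_nat (leq0n L) LM) /=.
  rewrite [X in _ + X](_ : _ = 0) ?addr0 // big_nat_cond.
  by apply: big1 => i /andP[/andP[/v0]].
rewrite (stable N) // -(stable _ Lk) (big_cat_nat (leq0n d) (leq_addl _ _)) /=.
rewrite addrC addrK big_add1 -[d in RHS]add0n big_addn addnK.
exact: eq_bigr.
Qed.

(** * Drazin inverse of a block triangular matrix *)

Lemma mulr_block (K : fieldType) (n : nat) (A B C D A' B' C' D' : 'M[K]_n) :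
  block_mx A B C D * block_mx A' B' C' D' =
  block_mx (A * A' + B * C') (A * B' + B * D') (C * A' + D * C') (C * B' + D * D').
Proof. exact: mulmx_block. Qed.

(** The Meyer-Rose corner X is verified directly: telescoping gives F X - X G = f - g, which is
    commutation, and complementary projections give the outer inverse identity. Terms of index at
    least [N] would be zero. *)
Lemma drazin_triangular (K : fieldType) (n N : nat) (F G : 'M[K]_n) :
    F ^+ N * (1 - F * drazin F) = 0 -> G ^+ N * (1 - G * drazin G) = 0 ->
  drazin (block_mx F 1 0 G) =
  block_mx (drazin F)
    (\sum_(0 <= i < N) F ^+ i * (1 - F * drazin F) * drazin G ^+ i.+2
     + \sum_(0 <= i < N) drazin F ^+ i.+2 * G ^+ i * (1 - G * drazin G)
     - drazin F * drazin G)
    0 (drazin G).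
Proof.
move=> Ft Gs.
set f := drazin F; set g := drazin G; set A := \sum_(_ <= _ < _) _.
set B := \sum_(_ <= _ < _) _; set X := A + B - f * g.
have FA : F * A - A * G = - ((1 - F * f) * g).
  (* Each summand contributes u (i+1) - u i, and u N = 0 by [Ft], so only - u 0 survives. *)
  pose u i := F ^+ i * (1 - F * f) * g ^+ i.+1.
  rewrite mulr_sumr mulr_suml -sumrB (@telescope_sumr_eq _ 0 N u) //.
    by rewrite /u Ft !mul0r sub0r mul1r expr1.
  by move=> i _; rewrite -[_ * g ^+ i.+2 * G]mulrA drazinX_mul 2!mulrA -exprS.
have FB : F * B - B * G = f * (1 - G * g).
  pose u i := - (f ^+ i.+1 * G ^+ i * (1 - G * g)).
  rewrite mulr_sumr mulr_suml -sumrB (@telescope_sumr_eq _ 0 N u) //.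
    by rewrite /u -mulrA Gs !mulr0 oppr0 sub0r mulr1 expr1 opprK.
  move=> i _; rewrite opprK 2!mulrA mul_drazinX -[_ * _ * G]mulrA.
  by rewrite drazin_idem_comm [_ * (G * _)]mulrA -[_ * G ^+ i * G]mulrA -exprSr addrC.
have FX : F * X + g = f + X * G.
  apply/eqP; rewrite -subr_eq0; apply/eqP; transitivity
    ((F * A - A * G) + (F * B - B * G) - (F * f * g - f * G * g) + g - f).
    rewrite /X !mulrBr !mulrDr !mulrBl !mulrDl !mulrA.
    rewrite -[f * g * G]mulrA -drazinC mulrA -/g.
    move: (F * A) (F * B) (A * G) (B * G) (F * f * g) (f * G * g) => a b c d e h.
    by apply/matrixP => i j; rewrite !mxE; ring.
  rewrite FA FB mulrBl mulrBr mul1r mulr1 mulrA.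
  move: (F * f * g) (f * G * g) => e h.
  by apply/matrixP => i j; rewrite !mxE; ring.
(* The projection [f * F] kills [A] and fixes [B]; the projection [G * g] fixes [A] and kills
   [B]. *)
have fFA : f * F * A = 0.
  rewrite mulr_sumr big1 // => i _; rewrite 2!mulrA -[f * F * _]mulrA -exprS.
  rewrite -{1}[f]expr1 -drazin_commX expr1 -[_ * f * _]mulrA mul_drazin_idem0.
  by rewrite mulr0 mul0r.
have AGg : A * G * g = A.
  rewrite !mulr_suml; apply: eq_bigr => i _.
  by rewrite -[_ * G]mulrA drazinX_mul -mulrA -exprSr.
have fFB : f * F * B = B.
  rewrite mulr_sumr; apply: eq_bigr => i _.
  by rewrite 2!mulrA -[f * F * _]mulrA mul_drazinX -exprS.
have BGg : B * G * g = 0.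
  rewrite !mulr_suml big1 // => i _.
  by rewrite -[_ * _ * G]mulrA drazin_idem_comm mulrA -[LHS]mulrA drazin_idem_mul0 mulr0.
have KTK : f * (F * X + g) + X * G * g = X.
  rewrite mulrDr mulrA /X mulrBr mulrDr fFA fFB 2!mulrBl 2!mulrDl AGg BGg.
  rewrite [f * F * (f * g)]mulrA drazinK -[f * g * G * g]mulrA -[f * g * _]mulrA.
  rewrite [g * (G * g)]mulrA drazinK.
  by move: (f * g) => x; apply/matrixP => i j; rewrite !mxE; ring.
pose T : 'M_(n + n) := block_mx F 1 0 G.
pose S : 'M_(n + n) := block_mx f X 0 g.
have TS : T * S = block_mx (F * f) (F * X + g) 0 (G * g).
  by rewrite mulr_block !mul0r !mulr0 !mul1r !addr0 !add0r.
have ST : S * T = T * S.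
  rewrite TS FX [F * f]drazinC [G * g]drazinC.
  by rewrite mulr_block !mul0r !mulr0 !mulr1 !addr0 !add0r.
have STS : S = S * T * S.
  rewrite -mulrA TS mulr_block !mul0r !mulr0 !addr0 !add0r.
  by rewrite !mulrA KTK !drazinK.
apply: drazin_eq; split; rewrite -/T -/S //.
have TX k : exists y, T ^+ k = block_mx (F ^+ k) y 0 (G ^+ k).
  elim: k => [|k [y Tk]]; first by exists 0; rewrite -scalar_mx_block.
  exists (F ^+ k + y * G); rewrite exprSr Tk mulr_block.
  by rewrite !(mul0r, mulr0, mulr1, addr0, add0r) -!exprSr.
have [y TN] := TX N.
have [z TNZ] : exists z, T ^+ N * (1 - T * S) = block_mx 0 z 0 0.
  exists (y - (F ^+ N * (F * X + g) + y * (G * g))).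
  rewrite mulrBr mulr1 TS TN mulr_block opp_block_mx add_block_mx.
  rewrite !(mul0r, mulr0, addr0, add0r, oppr0).
  by move: Ft Gs; rewrite !mulrBr !mulr1 => -> ->.
have cTS : GRing.comm T (1 - T * S).
  by apply: commrB; [exact: commr1 | rewrite /GRing.comm -mulrA -ST].
have ZZ : (1 - T * S) * (1 - T * S) = 1 - T * S.
  by rewrite mulrBr mulr1 mulrBl mul1r -[T * S * _]mulrA [S * _]mulrA -STS subrr subr0.
(* As 1 - T S is idempotent and commutes with [T], T^(2N) (1 - T S) is the square of T^N (1 - T S),
   which is strictly upper triangular by blocks; hence the exponent 2N. *)
exists (N + N)%N; rewrite exprSr -mulrA.
apply/eqP; rewrite -subr_eq0 -[X in X - _]mulr1 -mulrBr; apply/eqP.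
have cTN := commrX N (commr_sym cTS).
rewrite exprD -ZZ -mulrA [T ^+ N * ((1 - _) * _)]mulrA -cTN.
rewrite -[_ * T ^+ N * _]mulrA [LHS]mulrA !TNZ.
by rewrite mulr_block !(mul0r, mulr0, addr0); exact: block_mx_const.
Qed.

(** * From the triangular matrix to the Drazin inverse of M *)

Section BlockDrazin.
Variables (K : fieldType) (n : nat) (E F X : 'M[K]_n).
Hypotheses (EFF : E * F ^+ 2 = 0) (EFE : E * F * E = 0).
Let e := drazin E.
Let f := drazin F.
Hypothesis DT : drazin (block_mx F 1 0 (E ^+ 2)) = block_mx f X 0 (e ^+ 2).

Lemma mul_drazin_eq0 : E * f = 0.
Proof.
by rewrite -[f]expr1 -(mulX_drazinX F 2 0) mulrA EFF mul0r.
Qed.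

Lemma mul_mul_drazin_eq0 : E * F * e = 0.
Proof.
by rewrite -[e]expr1 -(mulX_drazinX E 1 0) expr1 mulrA EFE mul0r.
Qed.

(** Upper right block of T T^D = T^D T. *)
Lemma corner_comm : F * X + e ^+ 2 = f + X * E ^+ 2.
Proof.
have := drazinC (block_mx F 1 0 (E ^+ 2)).
rewrite DT !mulr_block !(mul0r, mulr0, mul1r, mulr1, addr0, add0r).
by case/eq_block_mx.
Qed.

(** Upper right block of (T^D)^2 T = T^D. *)
Lemma corner_outer : f * f + (f * X + X * e ^+ 2) * E ^+ 2 = X.
Proof.
have := drazinX_mul (block_mx F 1 0 (E ^+ 2)) 0.
rewrite expr2 expr1 DT !mulr_block !(mul0r, mulr0, mul1r, mulr1, addr0, add0r).
by case/eq_block_mx.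
Qed.

(** If Y f = 0, then [corner_outer] gives Y X = Y X G g, and [corner_comm] turns X G into F X + g -
    f. With Y = E F every resulting term vanishes; with Y = E only E g g = e^3 remains. *)
Lemma mul_corner : E * F * X = 0 /\ E * X = e ^+ 3.
Proof.
have eE : e ^+ 2 * E ^+ 2 = E ^+ 2 * e ^+ 2 by rewrite drazin_commX.
have e3 : E * e ^+ 2 * e ^+ 2 = e ^+ 3.
  by rewrite -[E]expr1 (mulX_drazinX E 1 0) -exprD.
have EFe : E * F * e ^+ 2 = 0 by rewrite expr2 mulrA mul_mul_drazin_eq0 mul0r.
have EFF' : E * F * F = 0 by rewrite -mulrA -expr2.
have EFf : E * F * f = 0 by rewrite -mulrA drazinC mulrA mul_drazin_eq0 mul0r.
have := corner_outer; have XG := corner_comm; have Ef := mul_drazin_eq0.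
move: (E ^+ 2) (e ^+ 2) eE e3 EFe XG => G g eE e3 EFe XG Xo.
have {}XG : X * G = F * X + g - f by rewrite XG addrC addKr.
have XE Y : Y * f = 0 -> Y * X = Y * X * G * g.
  move=> Yf; rewrite -[in LHS]Xo mulrDr !mulrDl mulrDr !mulrA Yf.
  by rewrite !(mul0r, add0r) -!mulrA eE.
have EFX0 : E * F * X = 0.
  rewrite XE // -[_ * X * _]mulrA XG !(mulrDr, mulrN) !mulrA EFF' EFe EFf.
  by rewrite mul0r !addr0 subr0 mul0r.
split=> //; rewrite XE // -[_ * X * _]mulrA XG !(mulrDr, mulrN) mulrA EFX0.
by rewrite Ef subr0 add0r.
Qed.

Lemma drazin_block :
  drazin (block_mx E 1 F 0) =
  block_mx (F * X * E + e + X * E * F) (F * X + e ^+ 2 + X * F - f)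
    (F * (F * X + e ^+ 2 + X * F - f)) (F * X * E + X * E * F - e ^+ 3 * F).
Proof.
set M := block_mx E 1 F 0; pose G := E ^+ 2.
(* Once the first block row is that of M^3, the first block row of T R = R M^2 forces the second. *)
pose R := block_mx ((F + G) * E + E * F) (F + G) (G * (G * E + E * F)) (G * (G + F)).
pose T := block_mx F 1 0 G; pose P : 'M[K]_(n + n) := block_mx 1 0 0 0.
have M2 : M ^+ 2 = block_mx (G + F) E (F * E) F.
  by rewrite expr2 mulr_block !(mul1r, mulr1, mul0r, mulr0, addr0).
have TR : T * R = R * M ^+ 2.
  rewrite M2 !mulr_block !(mul0r, mul1r, add0r).
  have EFF' : E * F * F = 0 by rewrite -mulrA -expr2.
  have EE Y : Y * E * E = Y * G by rewrite -mulrA -expr2.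
  have EG Y : Y * E * G = Y * G * E.
    rewrite -[LHS]mulrA -[RHS]mulrA; congr (Y * _).
    by rewrite /G -exprS -exprSr.
  have EFG : E * F * G = 0 by rewrite /G expr2 mulrA EFE mul0r.
  have G0 Z : E * Z = 0 -> G * Z = 0 by move=> EZ; rewrite /G expr2 -mulrA EZ mulr0.
  have GFE : G * F * E = 0 by rewrite -mulrA G0 // mulrA.
  have GFF : G * F * F = 0 by rewrite -mulrA G0 // mulrA.
  (* Since [mulrA] associates to the left, the vanishing triple products are also needed behind an
     arbitrary left factor. *)
  have zero Y A B C : A * B * C = 0 -> Y * A * B * C = 0 :> 'M[K]_n.
    by move=> ABC; rewrite -!mulrA [A * _]mulrA ABC mulr0.
  have zr := (EFF', EFG, GFE, GFF, EFE).
  have zr' Y := (zero Y _ _ _ EFF', zero Y _ _ _ EFG, zero Y _ _ _ GFE,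
    zero Y _ _ _ GFF, zero Y _ _ _ EFE).
  clearbody G; congr block_mx; rewrite !(mulrDl, mulrDr) ?mulrA ?(zr, zr', EE, EG);
    rewrite ?zr' ?mul0r ?addr0.
  - by rewrite -!addrA [LHS]addrC -!addrA.
  - by rewrite -!addrA [LHS]addrCA; congr (_ + _); exact: addrCA.
  - by [].
  - by [].
have PR : P * R = P * M ^+ 3.
  rewrite exprS M2 !mulr_block !(mul1r, mulr1, mul0r, mulr0, addr0).
  have GE : G * E = E * G by rewrite /G -exprS -exprSr.
  rewrite mulrDl mulrDr GE; congr block_mx; last exact: addrC.
  by rewrite -addrA addrC.
have := drazin_intertwine TR; rewrite drazin_sqr DT => KR.
(* Here M^D = M^3 (M^D)^4 and P M^3 = P R; applying [KR] twice turns R (M^D)^4 into (T^D)^2 R. *)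
have : P * drazin M = P * block_mx f X 0 (e ^+ 2) ^+ 2 * R.
  rewrite -[drazin M in LHS]expr1 -(mulX_drazinX M 3 0) mulrA -PR.
  rewrite -[LHS]mulrA -[RHS]mulrA.
  by congr (_ * _); rewrite [X in X * R]expr2 -mulrA KR mulrA KR -mulrA -exprD.
have := drazinC M; rewrite -[drazin M]submxK.
move: (ulsubmx _) (ursubmx _) (dlsubmx _) (drsubmx _) => a b c d.
rewrite expr2 !mulr_block !(mul0r, mulr0, mul1r, mulr1, addr0, add0r).
(* The right-hand blocks of the commutation read E b + d = a and F b = c, which determine the lower
   row from the upper one. *)
case/eq_block_mx => _ abd _ <-.
have [EFX EX] := mul_corner.
case/eq_block_mx => ea eb _ _.
have XG : (f * X + X * e ^+ 2) * G = X - f * f.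
  by apply/eqP; rewrite eq_sym subr_eq addrC corner_outer.
have XG' : X * G = F * X + e ^+ 2 - f by rewrite corner_comm addrC addKr.
have fF : f * f * F = f by rewrite -expr2 (drazinX_mul F 0).
have gE : e ^+ 2 * E = e by rewrite (drazinX_mul E 0).
clearbody G.
have {}ea : a = F * X * E + e + X * E * F.
  have XGE : X * G * E = F * X * E + e - f * E by rewrite XG' !mulrDl mulNr gE.
  rewrite ea [_ * (G * _)]mulrA XG !mulrDl !mulrDr !mulNr !mulrA fF XGE.
  move: (f * f * G * E) (f * E) (f * f * E * F) => x y z.
  by apply/matrixP => i j; rewrite !mxE; ring.
have {}eb : b = F * X + e ^+ 2 + X * F - f.
  rewrite eb [_ * (G * _)]mulrA XG !mulrDl !mulrDr !mulNr fF XG'.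
  by apply/matrixP => i j; rewrite !mxE; ring.
have ge : E * e ^+ 2 = e by rewrite (mul_drazinX E 0).
(* By [mul_corner] no X is left in E b, so d = a - E b brings in no new sums. *)
have Ed : E * b = e + e ^+ 3 * F.
  rewrite eb mulrBr mul_drazin_eq0 subr0 !mulrDr ge 2!mulrA EFX add0r.
  by rewrite EX.
rewrite eb ea; congr block_mx; move/(canRL (addKr _)): abd; rewrite Ed ea => ->.
move: (F * X * E) (X * E * F) (e ^+ 3 * F) => x y z.
by apply/matrixP => i j; rewrite !mxE; ring.
Qed.
End BlockDrazin.

(** * Matching the four blocks with the explicit sums *)

Section CornerSums.
Variables (K : fieldType) (n : nat) (E F : 'M[K]_n).
Let e := drazin E.
Let f := drazin F.
Let Epi := 1 - E * e.
Let Fpi := 1 - F * f.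
Let s := drazin_index E.
Let t := drazin_index F.
(** [a] and [b] are the terms of the two Meyer-Rose sums for the pair F, E^2, so that X = A + B - f
    e^2. *)
Let a i := F ^+ i * Fpi * e ^+ (2 * i + 4).
Let b i := f ^+ (i + 2) * E ^+ (2 * i) * Epi.

Let a0 i : (t <= i)%N -> a i = 0.
Proof. by move=> ti; rewrite /a mulX_drazin_idem // mul0r. Qed.

(** The factor E^(2i) E^pi vanishes once 2i >= s; the bound s./2 + 1 ensures this for both parities
    of s. *)
Let b0 i : (s./2.+1 <= i)%N -> b i = 0.
Proof.
move=> si; rewrite /b -mulrA mulX_drazin_idem ?mulr0 // -/s.
by rewrite -(odd_double_half s); lia.
Qed.

Let aE i : a i * E = F ^+ i * Fpi * e ^+ (2 * i + 3).
Proof. by rewrite /a addnS addn3 -mulrA drazinX_mul. Qed.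

Let Fa i : F * a i = F ^+ i.+1 * Fpi * e ^+ (2 * i + 4).
Proof. by rewrite 2!mulrA -exprS. Qed.

Let bE i : b i * E = f ^+ (i + 2) * E ^+ (2 * i + 1) * Epi.
Proof.
rewrite /b -[LHS]mulrA drazin_idem_comm [LHS]mulrA.
by rewrite -[_ * _ * E]mulrA addn1 -exprSr.
Qed.

Let Fb i : F * b i = f ^+ i.+1 * E ^+ (2 * i) * Epi.
Proof. by rewrite 2!mulrA addn2 mul_drazinX. Qed.

Let FaE i : F * a i * E = F ^+ i.+1 * Fpi * e ^+ (2 * i + 3).
Proof. by rewrite -mulrA aE 2!mulrA -exprS. Qed.

Let FbE i : F * b i * E = f ^+ i.+1 * E ^+ (2 * i + 1) * Epi.
Proof. by rewrite -mulrA bE 2!mulrA addn2 mul_drazinX. Qed.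

Let FFa i : F * (F * a i) = F ^+ i.+2 * Fpi * e ^+ (2 * i + 4).
Proof. by rewrite Fa 2!mulrA -exprS. Qed.

Let FFb i : F * (F * b i.+1) = f ^+ i.+1 * E ^+ (2 * i + 2) * Epi.
Proof. by rewrite Fb 2!mulrA mul_drazinX mulnSr. Qed.

(** The extra factors F allow an earlier cutoff than in [a0]; the first sum of Lambda, with t - 1
    terms and no offset, relies on it. *)
Let FFa0 i : (t.-1 <= i)%N -> F * (F * a i) = 0.
Proof.
move=> ti; rewrite FFa mulX_drazin_idem ?mul0r //.
by rewrite -/t; lia.
Qed.

Variable N : nat.
Hypotheses (tN : (t <= N)%N) (sN : (s./2.+1 <= N)%N).
Let A := \sum_(0 <= i < N) a i.
Let B := \sum_(0 <= i < N) b i.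


Let sum02 (v : nat -> 'M[K]_n) : \sum_(0 <= i < 2) v i = v 0%N + v 1%N.
Proof. by rewrite big_nat_recr //= big_nat1. Qed.

(** One call per sum, in the order of the formula. The subgoals left by [sum_from1] are the at most
    two skipped terms, the matching of exponents, the vanishing from [L] on, and the bounds. *)
Ltac from1 v d L :=
  rewrite (@sum_from1 _ _ v d _ N L);
  [ rewrite ?[\sum_(0 <= _ < 0) _]big_nil ?sum02 ?big_nat1
  | let i := fresh in move=> i; rewrite ?addn1 ?(FaE, FbE, FFa, FFb, Fa, Fb, aE, bE);
    rewrite -?[_ * e ^+ _ * e]mulrA -?exprSr;
    first [congr (_ ^+ _ * _ * _ ^+ _); lia | congr (_ ^+ _ * _ * _ ^+ _ * F); lia
         | congr (_ ^+ _ * _ ^+ _ * _); lia | congr (_ ^+ _ * _ ^+ _ * _ * F); lia]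
  | let i := fresh in let li := fresh in move=> i li;
    first [rewrite (FFa0 li) | rewrite (a0 li) | rewrite (b0 li)];
    by rewrite ?(mul0r, mulr0)
  | lia | lia].

Let Fpi_mul k : Fpi * e ^+ k * F = e ^+ k * F - F * f * e ^+ k * F.
Proof. by rewrite !mulrBl mul1r. Qed.

Let aEF0 : a 0 * E * F = e ^+ 3 * F - F * f * e ^+ 3 * F.
Proof. by rewrite aE mul1r Fpi_mul. Qed.

Let bEF0 : b 0 * E * F = f ^+ 2 * E * F - f ^+ 2 * E ^+ 2 * e * F.
Proof. by rewrite bE mulrBr mulr1 mulrBl -!mulrA. Qed.

(* [a] and [b] are made opaque so that no factor is pulled out of their bodies. *)
Ltac fold_sums := clearbody a b; rewrite -?mulr_suml -?mulr_sumr -/A -/B.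

(* [ring] needs a commutative ring: the monomials are generalized to matrices,
   and the additive identity is then checked entrywise. *)
Ltac abel :=
  repeat match goal with |- context [@GRing.mul ?V ?x ?y] =>
    let z := fresh "z" in set z := (@GRing.mul V x y); clearbody z end;
  apply/matrixP => ? ?; rewrite !mxE; ring.

Lemma corner_FXE X : X = A + B - f * e ^+ 2 ->
  F * X * E = F * A * E + F * B * E - F * f * e.
Proof.
move->; rewrite !(mulrBr, mulrBl, mulrDr, mulrDl) [F * (f * _)]mulrA.
by rewrite -[_ * e ^+ 2 * E]mulrA (drazinX_mul E 0).
Qed.

Lemma corner_XEF X : X = A + B - f * e ^+ 2 ->
  X * E * F = A * E * F + B * E * F - f * e * F.
Proof. by move->; rewrite !(mulrBl, mulrDl) -[_ * e ^+ 2 * E]mulrA (drazinX_mul E 0). Qed.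

(** The four sums are F A E, F B E, A E F and B E F without their first 0, 1, 1 and 2 terms; the
    skipped terms account for isolated summands of the formula. *)
Lemma corner_Gamma X : X = A + B - f * e ^+ 2 ->
    e + e ^+ 3 * F - f * e * F - f ^+ 2 * E ^+ 2 * e * F
    - F * f * e + f * E * Epi + f ^+ 2 * E * F
    - F * f * e ^+ 3 * F + f ^+ 3 * E ^+ 3 * Epi * F
    + \sum_(1 <= i < t.+1) F ^+ i * Fpi * e ^+ (2 * i + 1)
    + \sum_(1 <= i < (s./2).+1) f ^+ (i + 1) * E ^+ (2 * i + 1) * Epi
    + \sum_(1 <= i < t.+1) F ^+ i * Fpi * e ^+ (2 * i + 2) * e * F
    + \sum_(1 <= i < s./2) f ^+ (i + 3) * E ^+ (2 * i + 3) * Epi * F =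
  F * X * E + e + X * E * F.
Proof.
move=> XE.
from1 (fun i => F * a i * E) 0%N t.
from1 (fun i => F * b i * E) 1%N (s./2.+1).
from1 (fun i => a i * E * F) 1%N t.
(* If s./2 = 0 this sum is empty, and the two skipped terms still reach past the cutoff 1. *)
from1 (fun i => b i * E * F) 2%N (s./2.+1).

have FbE0 : F * b 0 * E = f * E * Epi by rewrite FbE.
have bEF1 : b 1 * E * F = f ^+ 3 * E ^+ 3 * Epi * F by rewrite bE.
rewrite (corner_FXE XE) (corner_XEF XE) aEF0 bEF0 FbE0 bEF1; fold_sums.
abel.
Qed.

Lemma corner_Delta X : X = A + B - f * e ^+ 2 ->
    e ^+ 2 + e ^+ 4 * F - f * e ^+ 2 * F - f ^+ 2 * E * e * F
    - F * f * e ^+ 2 + f * Epi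
    - F * f * e ^+ 4 * F + f ^+ 3 * E ^+ 2 * Epi * F
    + \sum_(1 <= i < t.+1) F ^+ i * Fpi * e ^+ (2 * i + 1) * e
    + \sum_(1 <= i < (s./2).+2) f ^+ (i + 1) * E ^+ (2 * i) * Epi
    + \sum_(1 <= i < t.+1) F ^+ i * Fpi * e ^+ (2 * i + 3) * e * F
    + \sum_(1 <= i < (s./2).+1) f ^+ (i + 3) * E ^+ (2 * i + 2) * Epi * F =
  F * X + e ^+ 2 + X * F - f.
Proof.
move=> XE.
from1 (fun i => F * a i) 0%N t.
from1 (fun i => F * b i) 1%N (s./2.+1).
from1 (fun i => a i * F) 1%N t.
from1 (fun i => b i * F) 2%N (s./2.+1).
have Fb0 : F * b 0 = f * Epi by rewrite Fb mulr1.
have aF0 : a 0 * F = e ^+ 4 * F - F * f * e ^+ 4 * F by rewrite /a mul1r Fpi_mul.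
(* The [f] arising from f^2 F accounts for the final [- f] of the block. *)
have bF0 : b 0 * F = f - f ^+ 2 * E * e * F.
  by rewrite /b mulr1 mulrBr mulr1 mulrBl (drazinX_mul F 0) [_ * (E * e)]mulrA.
have bF1 : b 1 * F = f ^+ 3 * E ^+ 2 * Epi * F by [].
have -> : F * X = F * A + F * B - F * f * e ^+ 2 by rewrite XE mulrBr mulrDr mulrA.
have -> : X * F = A * F + B * F - f * e ^+ 2 * F by rewrite XE mulrBl mulrDl.
rewrite Fb0 aF0 bF0 bF1; fold_sums.
abel.
Qed.

Lemma corner_Lambda X : X = A + B - f * e ^+ 2 ->
    F * Fpi * e ^+ 2 + F * f * Epi + F * Fpi * e ^+ 4 * F
    + f ^+ 2 * E ^+ 2 * Epi * F - F * f * e ^+ 2 * F - f * E * e * F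
    + \sum_(1 <= i < t) F ^+ (i + 1) * Fpi * e ^+ (2 * i + 2)
    + \sum_(1 <= i < (s./2).+2) f ^+ i * E ^+ (2 * i) * Epi
    + \sum_(1 <= i < t) F ^+ (i + 1) * Fpi * e ^+ (2 * i + 4) * F
    + \sum_(1 <= i < (s./2).+1) f ^+ (i + 2) * E ^+ (2 * i + 2) * Epi * F =
  F * (F * X + e ^+ 2 + X * F - f).
Proof.
move=> XE.
from1 (fun i => F * (F * a i)) 0%N t.-1.
from1 (fun i => F * (F * b i)) 1%N (s./2.+1).
from1 (fun i => F * a i * F) 1%N t.
from1 (fun i => F * b i * F) 2%N (s./2.+1).
have FFb0 : F * (F * b 0) = F * f * Epi by rewrite Fb mulr1 mulrA.
have FaF0 : F * a 0 * F = F * Fpi * e ^+ 4 * F by rewrite Fa.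
(* Likewise [F * f] accounts for the term - F f on the right. *)
have FbF0 : F * b 0 * F = F * f - f * E * e * F.
  by rewrite Fb mulr1 mulrBr mulr1 mulrBl -drazinC [_ * (E * e)]mulrA.
have FbF1 : F * b 1 * F = f ^+ 2 * E ^+ 2 * Epi * F by rewrite Fb.
have FFpi : F * Fpi * e ^+ 2 = F * e ^+ 2 - F * (F * (f * e ^+ 2)).
  by rewrite mulrBr mulr1 mulrBl -!mulrA.
have -> : F * (F * X + e ^+ 2 + X * F - f) =
    F * (F * A) + F * (F * B) - F * (F * (f * e ^+ 2)) + F * e ^+ 2
    + (F * A * F + F * B * F - F * f * e ^+ 2 * F) - F * f.
  by rewrite XE !(mulrDl, mulrDr, mulrBl, mulrBr, mulNr, mulrN) [F * (A * F)]mulrA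
    [F * (B * F)]mulrA [F * (f * _ * F)]mulrA [F * (f * _)]mulrA.
rewrite FFb0 FaF0 FbF0 FbF1 FFpi; fold_sums.
abel.
Qed.

(** The sums are those of [corner_Gamma], but the ones built from [a] skip one more initial term and
    the ones built from [b] one fewer. *)
Lemma corner_Xi X : X = A + B - f * e ^+ 2 ->
    - (F * f * e ^+ 3 * F) - f * e * F + F * Fpi * e ^+ 3 - F * f * e
    + F * Fpi * e ^+ 5 * F - f ^+ 2 * E ^+ 2 * e * F + f ^+ 2 * E * F
    + \sum_(1 <= i < t) F ^+ (i + 1) * Fpi * e ^+ (2 * i + 3)
    + \sum_(1 <= i < (s./2).+2) f ^+ i * E ^+ (2 * i - 1) * Epi
    + \sum_(1 <= i < t) F ^+ (i + 1) * Fpi * e ^+ (2 * i + 5) * F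
    + \sum_(1 <= i < (s./2).+1) f ^+ (i + 2) * E ^+ (2 * i + 1) * Epi * F =
  F * X * E + X * E * F - e ^+ 3 * F.
Proof.
move=> XE.
from1 (fun i => F * a i * E) 1%N t.
(* The truncated subtraction in 2i - 1 is harmless because i starts at 1. *)
from1 (fun i => F * b i * E) 0%N (s./2.+1).
from1 (fun i => a i * E * F) 2%N t.
from1 (fun i => b i * E * F) 1%N (s./2.+1).
have FaE0 : F * a 0 * E = F * Fpi * e ^+ 3 by rewrite FaE.
have aEF1 : a 1 * E * F = F * Fpi * e ^+ 5 * F by rewrite aE.
rewrite (corner_FXE XE) (corner_XEF XE) aEF0 bEF0 FaE0 aEF1; fold_sums.
abel.
Qed.
End CornerSums.

(** This is [drazin_triangular] at G = E^2: G G^D = E E^D, so both have the same complementary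
    idempotent, and G^N E^pi = 0 as soon as 2N >= s. *)
Lemma drazin_corner (K : fieldType) (n N : nat) (E F : 'M[K]_n) :
    (drazin_index F <= N)%N -> (drazin_index E <= 2 * N)%N ->
  drazin (block_mx F 1 0 (E ^+ 2)) =
  block_mx (drazin F)
    (\sum_(0 <= i < N) F ^+ i * (1 - F * drazin F) * drazin E ^+ (2 * i + 4)
     + \sum_(0 <= i < N) drazin F ^+ (i + 2) * E ^+ (2 * i) * (1 - E * drazin E)
     - drazin F * drazin E ^+ 2)
    0 (drazin E ^+ 2).
Proof.
move=> tN sN.
have E2 : E ^+ 2 * drazin (E ^+ 2) = E * drazin E.
  by rewrite drazin_sqr [E ^+ 2]expr2 -mulrA (mul_drazinX E 0).
rewrite (@drazin_triangular _ _ N) ?E2 -?exprM ?mulX_drazin_idem // drazin_sqr.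
congr (block_mx _ (_ + _ - _) _ _); apply: eq_bigr => i _.
  by rewrite -exprM !mulnS addnA addnC.
by rewrite -exprM addn2.
Qed.

Theorem corollary2p4 (R : realType) (n : nat) (E F : 'M[complex R]_n) :
  E * F ^+ 2 = 0 -> E * F * E = 0 ->
  let ED := drazin E in
  let FD := drazin F in
  let Epi := 1 - E * ED in
  let Fpi := 1 - F * FD in
  let s := drazin_index E in
  let t := drazin_index F in
  let Gamma :=
    ED + ED ^+ 3 * F - FD * ED * F - FD ^+ 2 * E ^+ 2 * ED * F
    - F * FD * ED + FD * E * Epi + FD ^+ 2 * E * F
    - F * FD * ED ^+ 3 * F + FD ^+ 3 * E ^+ 3 * Epi * F
    + \sum_(1 <= i < t.+1) F ^+ i * Fpi * ED ^+ (2 * i + 1)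
    + \sum_(1 <= i < (s./2).+1) FD ^+ (i + 1) * E ^+ (2 * i + 1) * Epi
    + \sum_(1 <= i < t.+1) F ^+ i * Fpi * ED ^+ (2 * i + 2) * ED * F
    + \sum_(1 <= i < s./2) FD ^+ (i + 3) * E ^+ (2 * i + 3) * Epi * F in
  let Delta :=
    ED ^+ 2 + ED ^+ 4 * F - FD * ED ^+ 2 * F - FD ^+ 2 * E * ED * F
    - F * FD * ED ^+ 2 + FD * Epi
    - F * FD * ED ^+ 4 * F + FD ^+ 3 * E ^+ 2 * Epi * F
    + \sum_(1 <= i < t.+1) F ^+ i * Fpi * ED ^+ (2 * i + 1) * ED
    + \sum_(1 <= i < (s./2).+2) FD ^+ (i + 1) * E ^+ (2 * i) * Epi
    + \sum_(1 <= i < t.+1) F ^+ i * Fpi * ED ^+ (2 * i + 3) * ED * F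
    + \sum_(1 <= i < (s./2).+1) FD ^+ (i + 3) * E ^+ (2 * i + 2) * Epi * F in
  let Lambda :=
    F * Fpi * ED ^+ 2 + F * FD * Epi + F * Fpi * ED ^+ 4 * F
    + FD ^+ 2 * E ^+ 2 * Epi * F - F * FD * ED ^+ 2 * F - FD * E * ED * F
    + \sum_(1 <= i < t) F ^+ (i + 1) * Fpi * ED ^+ (2 * i + 2)
    + \sum_(1 <= i < (s./2).+2) FD ^+ i * E ^+ (2 * i) * Epi
    + \sum_(1 <= i < t) F ^+ (i + 1) * Fpi * ED ^+ (2 * i + 4) * F
    + \sum_(1 <= i < (s./2).+1) FD ^+ (i + 2) * E ^+ (2 * i + 2) * Epi * F in
  let Xi :=
    - (F * FD * ED ^+ 3 * F) - FD * ED * F + F * Fpi * ED ^+ 3 - F * FD * ED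
    + F * Fpi * ED ^+ 5 * F - FD ^+ 2 * E ^+ 2 * ED * F + FD ^+ 2 * E * F
    + \sum_(1 <= i < t) F ^+ (i + 1) * Fpi * ED ^+ (2 * i + 3)
    + \sum_(1 <= i < (s./2).+2) FD ^+ i * E ^+ (2 * i - 1) * Epi
    + \sum_(1 <= i < t) F ^+ (i + 1) * Fpi * ED ^+ (2 * i + 5) * F
    + \sum_(1 <= i < (s./2).+1) FD ^+ (i + 2) * E ^+ (2 * i + 1) * Epi * F in
  drazin (block_mx E 1 F 0) = block_mx Gamma Delta Lambda Xi.

Proof.
move=> EFF EFE ED FD Epi Fpi s t; cbv zeta.
(* One common length that exceeds all the cutoffs t, s./2 + 1 and s / 2. *)
pose N := (s + t).+1.
have tN : (t <= N)%N by rewrite /N; lia.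
have sN : (s <= 2 * N)%N by rewrite /N; lia.
have hN : (s./2 < N)%N by rewrite /N; lia.
rewrite (drazin_block EFF EFE (drazin_corner tN sN)).
congr block_mx; symmetry.
- exact: (corner_Gamma tN hN).
- exact: (corner_Delta tN hN).
- exact: (corner_Lambda tN hN).
- exact: (corner_Xi tN hN).
Qed.
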